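(* If a finite simple graph $G$ has an acyclic vertex $k$-coloring, then $\operatorname{tlir}(G) \leq k$.
   Context: An acyclic vertex $k$-coloring is a proper vertex coloring with $k$ colors in which every two color classes together induce a forest. A total coloring of $G$ assigns a color to every vertex and every edge. For a color $c$ and a vertex $v$, the total $c$-degree of $v$ is the number of edges of color $c$ incident to $v$, plus $1$ if $v$ has color $c$. A total coloring is a locally irregular total coloring (TLIR coloring) if for every edge $uv$, with $c$ the color of $uv$, the total $c$-degrees of $u$ and $v$ differ. $\operatorname{tlir}(G)$ is the minimum number of colors in a TLIR coloring of $G$. *)

(* Defs.v *)
From mathcomp Require Import all_boot.

Set Implicit Arguments.
Unset Strict Implicit.
Unset Printing Implicit Defensive.

Record sgraph := SGraph {
  vertex :> finType;
  adj : rel vertex;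
  adj_sym : symmetric adj;
  adj_irrefl : irreflexive adj
}.

Definition edges (G : sgraph) : {set {set G}} :=
  [set [set p.1; p.2] | p in [set p : G * G | adj p.1 p.2]].

(* Edges are a type of their own, rather than arbitrary sets of vertices, so
   that the graph with no vertex has a total coloring with 0 colors. *)
Definition edge (G : sgraph) : finType := {a : {set G} | a \in edges G}.

Section InducedSubgraph.
Variables (G : sgraph) (S : {set G}).

Definition induced_adj : rel {x : G | x \in S} :=
  fun x y => adj (val x) (val y).

Fact induced_adj_sym : symmetric induced_adj.
Proof. by move=> x y; apply: adj_sym. Qed.

Fact induced_adj_irrefl : irreflexive induced_adj.
Proof. by move=> x; apply: adj_irrefl. Qed.

Definition induced : sgraph := SGraph induced_adj_sym induced_adj_irrefl.
End InducedSubgraph.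

(* In a simple graph, [ucycle] also holds of sequences of size 0 and of
   sequences [:: x; y] with x and y adjacent; neither is a graph cycle. *)
Definition forest (G : sgraph) : Prop :=
  forall p : seq G, 2 < size p -> ~ ucycle (@adj G) p.

Definition proper_coloring (G : sgraph) (k : nat) (f : G -> 'I_k) : Prop :=
  forall u v : G, adj u v -> f u <> f v.

Definition color_class (G : sgraph) (k : nat) (f : G -> 'I_k) (i : 'I_k) :
  {set G} := [set v | f v == i].

Definition acyclic_coloring (G : sgraph) (k : nat) (f : G -> 'I_k) : Prop :=
  proper_coloring f /\
  forall i j : 'I_k, i <> j ->
    forest (induced (color_class f i :|: color_class f j)).

Definition total_coloring (G : sgraph) (k : nat) : finType :=
  {ffun G + edge G -> 'I_k}.

Definition total_degree (G : sgraph) (k : nat) (phi : total_coloring G k)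
    (c : 'I_k) (v : G) : nat :=
  #|[set a : edge G | (v \in val a) && (phi (inr a) == c)]|
    + (phi (inl v) == c).

Definition tlir_coloring (G : sgraph) (k : nat) (phi : total_coloring G k) :
  bool :=
  [forall a : edge G, forall u : G, forall v : G,
    (val a == [set u; v]) ==>
    (total_degree phi (phi (inr a)) u != total_degree phi (phi (inr a)) v)].

Definition tlir_colorable (G : sgraph) (k : nat) : bool :=
  [exists phi : total_coloring G k, tlir_coloring phi].

(* Give every vertex its own color, and every edge the color of one of its
   ends: each color then spans a star whose center alone has that color. *)
Fact tlir_colorable_ex (G : sgraph) : exists k, tlir_colorable G k.
Proof.
have nonempty (a : edge G) : exists x : G, x \in val a.
  by case: a => a /= /imsetP[p _ ->]; exists p.1; rewrite !inE eqxx.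
pose c (a : edge G) := xchoose (nonempty a).
have cP a : c a \in val a by apply: xchooseP.
exists #|G|; apply/existsP.
pose phi : total_coloring G #|G| :=
  [ffun s => enum_rank (match s with inl v => v | inr a => c a end)].
exists phi.
have phil (v : G) : phi (inl v) = enum_rank v by rewrite ffunE.
have phir (a : edge G) : phi (inr a) = enum_rank (c a) by rewrite ffunE.
have center (a : edge G) (w : G) : w \in val a -> w != c a ->
    total_degree phi (phi (inr a)) w < total_degree phi (phi (inr a)) (c a).
  move=> wa wc; rewrite /total_degree !phil !phir !(inj_eq enum_rank_inj) eqxx.
  rewrite (negPf wc) addn0 addn1 ltnS.
  apply/subset_leq_card/subsetP => b; rewrite !inE => /andP[_].
  rewrite !phir (inj_eq enum_rank_inj) => /eqP cb.
  by rewrite -cb cP eqxx.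
apply/forallP => a; apply/forallP => u; apply/forallP => v; apply/implyP.
move=> /eqP eqa.
have neq_uv : u != v.
  apply/eqP => uv; case: a eqa => a /= /imsetP[p]; rewrite inE => pP ->.
  rewrite uv setUid => eqp.
  have : p.1 \in [set v] by rewrite -eqp !inE eqxx.
  have : p.2 \in [set v] by rewrite -eqp !inE eqxx orbT.
  rewrite !inE => /eqP p2 /eqP p1.
  by rewrite p1 p2 adj_irrefl in pP.
have ua : u \in val a by rewrite eqa !inE eqxx.
have va : v \in val a by rewrite eqa !inE eqxx orbT.
have := cP a; rewrite {1}eqa !inE => /orP[] /eqP ca.
  by have := center a v va; rewrite ca eq_sym => /(_ neq_uv) h; rewrite gtn_eqF.
by have := center a u ua; rewrite ca => /(_ neq_uv) h; rewrite ltn_eqF.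
Qed.

Definition tlir (G : sgraph) : nat := ex_minn (tlir_colorable_ex G).

(* Main.v *)
Require Import Defs.
From mathcomp Require Import all_boot.

(** Each two-colored forest can be rooted, so that a vertex has at most one
    parent of each color. Keep the vertex coloring and give each edge the color
    of its parent end. If the edge from [w] to its parent [c] has color
    [i = f c], then no other edge at [w] has color [i], and [f w <> i]; hence
    the edges of color [i] at [w] are among those at [c], and [c] gains one more
    from its own color. *)

(* Otherwise simple paths can be prolonged at their head forever. *)
Lemma forest_leaf (G : sgraph) (S : {set G}) :
  forest G -> S != set0 ->
  exists2 x, x \in S &
    {in S &, forall y z, adj x y -> adj x z -> y = z}.
Proof.
move=> forestG /set0Pn[x0 x0S].
pose leaf x := [forall y in S, forall z in S, adj x y ==> adj x z ==> (y == z)].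
have [x /andP[xS /forall_inP leafx]|noleaf] := pickP [pred x in S | leaf x].
  exists x => // y z yS zS xy xz; apply/eqP.
  by have /forall_inP/(_ z zS) := leafx y yS; rewrite xy xz.
(* A vertex with two neighbors in [S] has one other than a prescribed [y], so a path can leave [x]
   without turning back. *)
have next x y : x \in S -> exists z, [/\ z \in S, z != y & adj x z].
  move=> xS; have := noleaf x; rewrite /= xS /= => /negbT/forall_inPn[z1 z1S].
  case/forall_inPn => z2 z2S; rewrite !negb_imply => /and3P[xz1 xz2 z12].
  have [z1y|] := eqVneq z1 y; last by exists z1.
  by exists z2; split; rewrite // -z1y eq_sym.
(* Such a path has [n + 2] distinct vertices, too many when [n] is [#|G|]. *)
suff long n : exists x y s, [/\ uniq [:: x, y & s], path (@adj G) x (y :: s),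
    x \in S & size s = n].
  have [x [y [s [/card_uniqP us _ _ sz]]]] := long #|G|.
  by have := max_card [in [:: x, y & s]]; rewrite us /= sz -ltnS leqNgt leqnSn.
elim: n => [|n [x [y [s [us xys xS <-]]]]].
  have [z [zS _ x0z]] := next x0 x0 x0S.
  exists z, x0, [::]; split=> //=; last by rewrite adj_sym x0z.
  rewrite inE andbT; apply/eqP => zx0.
  by rewrite zx0 adj_irrefl in x0z.
have [z [zS zy xz]] := next x y xS.
have [zs|zs] := boolP (z \in s); last first.
  exists z, x, (y :: s); split=> //; last by rewrite /= adj_sym xz.
  rewrite cons_uniq us andbT !inE (negPf zy) (negPf zs) !orbF.
  by apply/eqP => zx; rewrite zx adj_irrefl in xz.
(* Cut at [z], the path closes up through the edge from [z] to [x]; since [z] comes after [y], this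
   cycle has at least three vertices. *)
case/splitPr: s / zs us xys => s1 s2 us xys.
case: (forestG [:: x, y & rcons s1 z]); first by rewrite /= size_rcons.
move: us xys; rewrite -cat_rcons -!cat_cons cat_uniq cat_path.
move=> /andP[us _] /andP[xys _].
apply/andP; split=> //.
by move: xys; rewrite /= => /andP[-> yz]; rewrite rcons_path yz last_rcons adj_sym.
Qed.

(** Remove a leaf, whose parent is its only remaining neighbor, and recurse. The induction runs over
    vertex subsets of the fixed graph [G], so being a forest never has to be passed on to
    subgraphs. *)
Lemma forest_parent (G : sgraph) : forest G ->
  exists p : G -> G, forall x y, adj x y -> p x = y \/ p y = x.
Proof.
move=> forestG.
suff [p pP] : exists p : G -> G,
    {in [set: G] &, forall x y, adj x y -> p x = y \/ p y = x}.
  by exists p => x y; apply: pP; rewrite inE.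
have [n] := ubnP #|[set: G]|; elim: n [set: G] => // n IHn S.
have [->|S0] := eqVneq S set0; first by exists id => x y; rewrite inE.
have [l lS leafl] := forest_leaf _ S forestG S0.
rewrite (cardsD1 l) lS ltnS => /IHn[p pP].
(* The default [l] occurs only if [l] has no neighbor in [S], where nothing is required of it. *)
exists (fun x => if x == l then odflt l [pick y in S | adj l y] else p x).
have pl y : y \in S -> adj l y -> odflt l [pick y in S | adj l y] = y.
  move=> yS ly; case: pickP => [z /andP[zS lz]|/(_ y)]; first exact: leafl.
  by rewrite yS ly.
move=> x y xS yS xy; have [xl|xl] := eqVneq x l.
  by left; apply: pl; rewrite -?xl.
have [yl|yl] := eqVneq y l; first by right; apply: pl; rewrite -?yl 1?adj_sym.
by apply: pP; rewrite // !inE ?xl ?yl.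
Qed.

Lemma induced_forest_parent (G : sgraph) (S : {set G}) :
  forest (induced S) ->
  exists p : G -> G, {in S &, forall x y, adj x y -> p x = y \/ p y = x}.
Proof.
move=> /forest_parent[p pP].
exists (fun x => if insub x is Some s then val (p s) else x) => x y xS yS xy.
rewrite !insubT; have [->|->] := pP (Sub x xS) (Sub y yS) xy.
  by left.
by right.
Qed.

(* [par u v] says that [v] is the parent of [u] in the forest on the classes of
   [f u] and [f v]. *)
Lemma acyclic_coloring_parent (G : sgraph) (k : nat) (f : G -> 'I_k) :
  acyclic_coloring f ->
  exists par : rel G,
    (forall u v, adj u v -> par u v || par v u) /\
    (forall u v w, par u v -> par u w -> f v = f w -> v = w).
Proof.
move=> [properf forestf].
(* Indexing by the unordered pair of colors makes both ends of an edge consult the same rooted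
   forest. *)
have [p pP] : exists p : {set 'I_k} -> G -> G, forall (A : {set 'I_k}) u v,
    adj u v -> A = [set f u; f v] -> p A u = v \/ p A v = u.
  apply: (@fin_all_exists _ (fun=> G -> G)
    (fun A p => forall u v, adj u v -> A = [set f u; f v] -> p u = v \/ p v = u)).
  move=> A; have [/cards2P[i [j [/eqP ij Aij]]]|A2] := boolP (#|A| == 2).
    have [p pP] := induced_forest_parent _ _ (forestf i j ij).
    have inS w : w \in color_class f i :|: color_class f j = (f w \in A).
      by rewrite Aij !inE.
    by exists p => u v uv Auv; apply: pP; rewrite ?inS ?Auv ?set21 ?set22.
  (* The ends of an edge have two distinct colors, so any other [A] imposes no condition. *)
  exists id => u v /properf/eqP fuv Auv.
  by rewrite Auv cards2 fuv in A2.
exists (fun u v => p [set f u; f v] u == v); split.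
  move=> u v uv; rewrite (setUC [set f v]).
  by have [->|->] := pP _ u v uv erefl; rewrite eqxx ?orbT.
(* Equal colors of [v] and [w] select the same forest, where [u] has a single parent. *)
by move=> u v w /eqP puv /eqP puw fvw; rewrite -puw -fvw puv.
Qed.

Lemma edgeP (G : sgraph) (a : edge G) :
  exists u v, val a = [set u; v] /\ adj u v.
Proof.
by case: a => a /= /imsetP[[u v]]; rewrite inE => uv ->; exists u, v.
Qed.

Lemma edge_ends (G : sgraph) (a : edge G) (x y : G) :
  x \in val a -> y \in val a -> x != y -> val a = [set x; y] /\ adj x y.
Proof.
have [u [v [-> uv]]] := edgeP G a; rewrite !inE.
move=> /orP[] /eqP-> /orP[] /eqP->; rewrite ?eqxx // => _.
by rewrite setUC adj_sym.
Qed.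

Theorem theorem5 (G : sgraph) (k : nat) :
  (exists f : G -> 'I_k, acyclic_coloring f) -> tlir G <= k.
Proof.
move=> [f acyclicf]; have [properf _] := acyclicf.
have [par [par_total par_uniq]] := acyclic_coloring_parent _ _ _ acyclicf.
rewrite /tlir; case: ex_minnP => m _; apply; apply/existsP.
have [c cP] : exists c : edge G -> G, forall a,
    c a \in val a /\ forall x, x \in val a -> x != c a -> par x (c a).
  apply: (@fin_all_exists (edge G) (fun=> G)
    (fun a c => c \in val a /\ forall x, x \in val a -> x != c -> par x c)).
  move=> a; have [u [v [-> uv]]] := edgeP G a.
  have [puv|pvu] := orP (par_total u v uv); [exists v|exists u].
    by split=> [|x]; rewrite !inE ?eqxx ?orbT // => /orP[] /eqP->; rewrite ?eqxx.
  by split=> [|x]; rewrite !inE ?eqxx ?orbT // => /orP[] /eqP->; rewrite ?eqxx.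
pose phi : total_coloring G k :=
  [ffun s => match s with inl v => f v | inr a => f (c a) end].
have phil v : phi (inl v) = f v by rewrite ffunE.
have phir a : phi (inr a) = f (c a) by rewrite ffunE.
have lt_center (a : edge G) w : w \in val a -> w != c a ->
    total_degree phi (phi (inr a)) w < total_degree phi (phi (inr a)) (c a).
  move=> wa wc; have [ca parc] := cP a.
  have [aE /properf/eqP fwc] := edge_ends _ _ _ _ wa ca wc.
  rewrite /total_degree phir !phil eqxx (negPf fwc) addn0 addn1 ltnS.
  apply/subset_leq_card/subsetP => b; rewrite !inE => /andP[wb].
  rewrite !phir => /eqP fcb; rewrite fcb eqxx andbT.
  have [cb parcb] := cP b.
  (* [c b] has the color of [c a], which differs from that of its neighbor [w]. *)
  have wcb : w != c b by apply: contraNneq fwc => ->; rewrite fcb.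
  (* Both [c b] and [c a] are parents of [w] of the same color, so they coincide and [b] is an edge
     at [c a]. *)
  by rewrite -(par_uniq _ _ _ (parcb w wb wcb) (parc w wa wc) fcb).
exists phi; apply/forallP => a; apply/forallP => u; apply/forallP => v.
apply/implyP => /eqP aE; have [ca _] := cP a.
have ua : u \in val a by rewrite aE set21.
have va : v \in val a by rewrite aE set22.
(* [tlir_coloring] quantifies over all [u] and [v], so the case of a singleton edge must be excluded
   by irreflexivity. *)
have uv : u != v.
  have [x [y [a2 xy]]] := edgeP G a.
  apply: contraTneq xy => uv.
  move: aE; rewrite uv setUid a2 => /setP xyv.
  move: (xyv x) (xyv y); rewrite !inE !eqxx orbT /= => /esym/eqP-> /esym/eqP->.
  by rewrite adj_irrefl.
have [uc|uc] := eqVneq u (c a); last first.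
  move: ca; rewrite {1}aE !inE eq_sym (negPf uc) /= => /eqP vc.
  by rewrite -vc ltn_eqF // lt_center.
by rewrite uc gtn_eqF // lt_center // -uc eq_sym.
Qed.
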